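(* Let $n\ge 3$. (a) There exists an origin symmetric convex body in $\mathbb{R}^n$ which is neither an ellipsoid nor a body of revolution and all of whose central sections are unconditional, i.e. $K\cap H$ is unconditional in $H$ for every linear subspace $H$ of $\mathbb{R}^n$ with $1\le\dim H\le n-1$. (b) There exists an origin symmetric convex body in $\mathbb{R}^n$ which is neither an ellipsoid nor a body of revolution and all of whose orthogonal projections are unconditional, i.e. $K|H$ is unconditional in $H$ for every linear subspace $H$ of $\mathbb{R}^n$ with $1\le\dim H\le n-1$.
   Context: A convex body is a compact convex set with non-empty interior; it is origin symmetric if $K=-K$. $K|H$ is the orthogonal projection of $K$ onto $H$. A subset $A$ of an $m$-dimensional Euclidean space $H$ is called unconditional if there is an orthonormal basis $\{e_1,\dots,e_m\}$ of $H$ such that $A$ is symmetric with respect to each of the hyperplanes $e_1^\perp,\dots,e_m^\perp$ of $H$. A body of revolution is a body invariant under all rotations of $\mathbb{R}^n$ that fix some line (the axis) pointwise. *)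

(* Defs.v *)
From HB Require Import structures.
From mathcomp Require Import all_boot all_order all_algebra.
From mathcomp Require Import all_classical all_reals all_analysis.

Set Implicit Arguments.
Unset Strict Implicit.
Unset Printing Implicit Defensive.

Import Order.TTheory GRing.Theory Num.Theory.
Import numFieldNormedType.Exports.

Local Open Scope classical_set_scope.
Local Open Scope ring_scope.

(* R^n is 'rV[R]_n.  The library norm on matrices is the sup norm, so the
   Euclidean structure is given by [dot]; the two induce the same topology. *)
Definition dot (R : realType) (n : nat) (x y : 'rV[R]_n) : R :=
  \sum_(i < n) x 0 i * y 0 i.

Definition convex_body (R : realType) (n : nat) (K : set 'rV[R]_n) : Prop :=
  [/\ compact K, convex_set K & K° !=set0].

Definition origin_symmetric (R : realType) (n : nat) (K : set 'rV[R]_n) : Prop :=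
  [set - x | x in K] = K.

(* Reflection in the hyperplane orthogonal to the unit vector e.  When e lies in
   a subspace H it restricts to the reflection of H in the orthogonal
   complement of e in H. *)
Definition reflection (R : realType) (n : nat) (e x : 'rV[R]_n) : 'rV[R]_n :=
  x - (2 * dot x e) *: e.

Definition orthonormal_basis (R : realType) (n : nat) (H : {vspace 'rV[R]_n})
    (e : (\dim H).-tuple 'rV[R]_n) : Prop :=
  basis_of H e /\
  forall i j : 'I_(\dim H), dot (tnth e i) (tnth e j) = (i == j)%:R.

Definition unconditional (R : realType) (n : nat) (H : {vspace 'rV[R]_n})
    (A : set 'rV[R]_n) : Prop :=
  A `<=` [set` H] /\
  exists e : (\dim H).-tuple 'rV[R]_n,
    orthonormal_basis e /\
    forall i : 'I_(\dim H), [set reflection (tnth e i) x | x in A] = A.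

Definition section (R : realType) (n : nat) (K : set 'rV[R]_n)
    (H : {vspace 'rV[R]_n}) : set 'rV[R]_n :=
  K `&` [set` H].

(* y is the orthogonal projection of x onto H when y is in H and x - y is
   orthogonal to H. *)
Definition projection (R : realType) (n : nat) (K : set 'rV[R]_n)
    (H : {vspace 'rV[R]_n}) : set 'rV[R]_n :=
  [set y | y \in H /\
     exists2 x, K x & forall h, h \in H -> dot (x - y) h = 0].

Definition ellipsoid (R : realType) (n : nat) (K : set 'rV[R]_n) : Prop :=
  exists (c : 'rV[R]_n) (A : 'M[R]_n),
    A \in unitmx /\ K = [set c + x *m A | x in [set x | dot x x <= 1]].

Definition rotation (R : realType) (n : nat) (Q : 'M[R]_n) : Prop :=
  Q *m Q^T = 1%:M /\ \det Q = 1.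

(* The axis p + R u may be any affine line; the rotations fixing it pointwise
   are the maps x |-> p + (x - p) Q with Q in SO(n) and u Q = u. *)
Definition body_of_revolution (R : realType) (n : nat) (K : set 'rV[R]_n) : Prop :=
  exists p u : 'rV[R]_n, u != 0 /\
    forall Q : 'M[R]_n, rotation Q -> u *m Q = u ->
      [set p + (x - p) *m Q | x in K] = K.

(* Main.v *)
Require Import Defs.
From HB Require Import structures.
From mathcomp Require Import all_boot all_order all_algebra.
From mathcomp Require Import all_classical all_reals all_analysis.
From mathcomp Require Import ring lra.

Set Implicit Arguments.
Unset Strict Implicit.
Unset Printing Implicit Defensive.

Import Order.TTheory GRing.Theory Num.Theory.
Import numFieldNormedType.Exports.

Local Open Scope classical_set_scope.
Local Open Scope ring_scope.

(* Both examples combine two quadratic forms, the Euclidean one and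
   x |-> |x M|^2 with M = diag(2, 3, 0, ..., 0), because two quadratic forms are
   simultaneously diagonalizable on every subspace H by an orthonormal basis.
   For (a) take the intersection of the unit ball B with the elliptic cylinder
   |x M| <= 1; for (b) take the Minkowski sum B + B M of the ball and a flat
   ellipse.  Both bodies have segments in their boundary, so they are not
   ellipsoids.  A rotation preserving either body must preserve the axis of the
   eigenvalue 3, since this axis carries the points closest to the origin in the
   boundary in (a), and the points furthest from it in (b).  Hence an axis of
   revolution would be this one, but then a quarter turn exchanging the first
   and third axes would preserve the body, which it does not. *)

(** * Euclidean inner product: algebra, continuity, boundedness *)

Section Dot.
Context {R : realType}.

Lemma dotC n (x y : 'rV[R]_n) : dot x y = dot y x.
Proof. by apply: eq_bigr => i _; rewrite mulrC. Qed.

Lemma dotDl n (x y z : 'rV[R]_n) : dot (x + y) z = dot x z + dot y z.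
Proof. by rewrite -big_split; apply: eq_bigr => i _; rewrite mxE mulrDl. Qed.

Lemma dotZl n a (x z : 'rV[R]_n) : dot (a *: x) z = a * dot x z.
Proof. by rewrite mulr_sumr; apply: eq_bigr => i _; rewrite mxE mulrA. Qed.

Lemma dotDr n (x y z : 'rV[R]_n) : dot z (x + y) = dot z x + dot z y.
Proof. by rewrite !(dotC z) dotDl. Qed.

Lemma dotZr n a (x z : 'rV[R]_n) : dot z (a *: x) = a * dot z x.
Proof. by rewrite !(dotC z) dotZl. Qed.

Lemma dotNl n (x z : 'rV[R]_n) : dot (- x) z = - dot x z.
Proof. by rewrite -scaleN1r dotZl mulN1r. Qed.

Lemma dotNr n (x z : 'rV[R]_n) : dot z (- x) = - dot z x.
Proof. by rewrite !(dotC z) dotNl. Qed.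

Definition dotE := (dotDl, dotDr, dotNl, dotNr, dotZl, dotZr).

Lemma dot0l n (x : 'rV[R]_n) : dot 0 x = 0.
Proof. by rewrite -(scale0r 0) dotZl mul0r. Qed.

Lemma dot_sumr n I (r : seq I) (P : pred I) (F : I -> 'rV[R]_n) (x : 'rV[R]_n) :
  dot x (\sum_(i <- r | P i) F i) = \sum_(i <- r | P i) dot x (F i).
Proof.
elim/big_rec2: _ => [|i y z _ <-]; last by rewrite dotDr.
by rewrite dotC dot0l.
Qed.

Lemma dot_mulmxl m n (x : 'rV[R]_m) (A : 'M[R]_(m, n)) (y : 'rV[R]_n) :
  dot (x *m A) y = dot x (y *m A^T).
Proof.
transitivity (\sum_(j < n) \sum_(i < m) x 0 i * A i j * y 0 j).
  by apply: eq_bigr => j _; rewrite mxE mulr_suml.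
rewrite exchange_big; apply: eq_bigr => i _; rewrite mxE mulr_sumr.
by apply: eq_bigr => j _; rewrite mxE -mulrA [A i j * _]mulrC.
Qed.

Lemma dot_ge0 n (x : 'rV[R]_n) : 0 <= dot x x.
Proof. by apply: sumr_ge0 => i _; rewrite -expr2 sqr_ge0. Qed.

Lemma dot_eq0 n (x : 'rV[R]_n) : (dot x x == 0) = (x == 0).
Proof.
apply/eqP/eqP => [x0|->]; last exact: dot0l.
apply/rowP => i; rewrite mxE; apply/eqP; rewrite -sqrf_eq0 expr2; apply/eqP.
by apply: (psumr_eq0P _ x0) => // j _; rewrite -expr2 sqr_ge0.
Qed.

Lemma dot_gt0 n (x : 'rV[R]_n) : x != 0 -> 0 < dot x x.
Proof. by move=> x0; rewrite lt_neqAle dot_ge0 eq_sym dot_eq0 x0. Qed.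

Lemma dot_normalize n (x : 'rV[R]_n) : x != 0 ->
  dot ((Num.sqrt (dot x x))^-1 *: x) ((Num.sqrt (dot x x))^-1 *: x) = 1.
Proof.
move=> x0; have xx := dot_gt0 x0.
rewrite !dotE mulrA -invfM -expr2 sqr_sqrtr ?ltW// mulVf// gt_eqF//.
Qed.

Lemma coord_dot n (x : 'rV[R]_n) (i : 'I_n) : x 0 i = dot x (delta_mx 0 i).
Proof.
rewrite /dot (bigD1 i)//= mxE !eqxx mulr1 big1 ?addr0// => j /negbTE ji.
by rewrite mxE ji andbF mulr0.
Qed.

Lemma coord_sqr_le_dot n (x : 'rV[R]_n) (i : 'I_n) : x 0 i ^+ 2 <= dot x x.
Proof.
rewrite /dot (bigD1 i)//= expr2 lerDl; apply: sumr_ge0 => j _.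
by rewrite -expr2 sqr_ge0.
Qed.

Lemma dot_continuous n (T : topologicalType) (f g : T -> 'rV[R]_n) :
  continuous f -> continuous g -> continuous (fun x => dot (f x) (g x)).
Proof.
move=> cf cg; rewrite /dot.
apply: continuous_big => [|i _]; first exact: add_continuous.
have cont h : continuous h -> continuous (fun x : T => (h x : 'rV[R]_n) 0 i).
  move=> ch x; apply: (@continuous_comp _ _ _ h (fun y : 'rV[R]_n => y 0 i)).
    exact: ch.
  exact: coord_continuous.
by move=> x; apply: cvgM; exact: cont.
Qed.

Lemma mulmx_continuous m n (A : 'M[R]_(m, n)) :
  continuous (fun x : 'rV[R]_m => x *m A).
Proof.
under eq_fun do rewrite mulmx_sum_row.
apply: continuous_big => [|i _]; first exact: add_continuous.
by move=> x; apply: cvgZr_tmp; [exact: nbhs_filter|exact: coord_continuous].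
Qed.

Lemma sqr_dot_continuous n : continuous (fun x : 'rV[R]_n => dot x x).
Proof. by apply: dot_continuous => x; exact: cvg_id. Qed.

Lemma sqr_dot_mulmx_continuous m n (A : 'M[R]_(m, n)) :
  continuous (fun x : 'rV[R]_m => dot (x *m A) (x *m A)).
Proof. by apply: dot_continuous; exact: mulmx_continuous. Qed.

Lemma bounded_dot n (A : set 'rV[R]_n) (C : R) :
  (forall x, A x -> dot x x <= C) -> bounded_set A.
Proof.
move=> AC; exists (1 + C); split; first exact: num_real.
move=> M CM x Ax /=; rewrite [leLHS]/Num.norm /= mx_normrE.
have C0 : 0 <= C by rewrite (le_trans (dot_ge0 x)) ?AC.
apply/bigmax_leP; split; first by apply: ltW; apply: lt_trans CM; lra.
move=> [i j] _ /=; rewrite (ord1 i); apply: (le_trans _ (ltW CM)).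
have := le_trans (coord_sqr_le_dot x j) (AC _ Ax).
rewrite -real_normK ?num_real// => h.
have [//|h1] := leP `|x 0 j| (1 + C); nra.
Qed.

End Dot.

(** * Spectral theorem for a symmetric form restricted to a subspace *)

Section Spectral.
Context {R : realType}.

(** A vector lies in [H] exactly when a linear projector onto [H] fixes it, so [H] is the zero set
    of a continuous function. *)
Lemma closed_vspace n (H : {vspace 'rV[R]_n}) : closed [set` H].
Proof.
pose A := lin1_mx (projv H) - 1%:M.
have -> : [set` H] = (fun x => dot (x *m A) (x *m A)) @^-1` [set 0].
  apply/seteqP; split=> x /=.
    by move=> xH; rewrite mulmxBr mul_rV_lin1 mulmx1 /= projv_id// subrr dot0l.
  move=> /eqP; rewrite dot_eq0 mulmxBr mul_rV_lin1 mulmx1 /= subr_eq0 => /eqP <-.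
  exact: memv_proj.
apply: closed_comp; last exact: closed_eq.
by move=> x _; exact: sqr_dot_mulmx_continuous.
Qed.

Lemma compact_unit_sphere n (H : {vspace 'rV[R]_n}) :
  compact ([set` H] `&` [set x | dot x x = 1]).
Proof.
apply: bounded_closed_compact.
  by apply: (@bounded_dot _ _ _ 1) => x [_ ->].
apply: closedI; first exact: closed_vspace.
apply: (@closed_comp _ _ (fun x : 'rV[R]_n => dot x x) [set 1]);
    last exact: closed_eq.
by move=> x _; exact: sqr_dot_continuous.
Qed.

(* u maximizes the quadratic form on the unit sphere of H, where its first
   variation vanishes. *)
Lemma unit_eigenvector n (S : 'M[R]_n) (H : {vspace 'rV[R]_n}) :
  S^T = S -> H != 0%VS ->
  exists u, [/\ u \in H, dot u u = 1 &
    forall h, h \in H -> dot (u *m S) h = dot (u *m S) u * dot u h].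
Proof.
move=> ST H0.
have SC x y : dot (x *m S) y = dot (y *m S) x.
  by rewrite dot_mulmxl ST dotC.
have cH := @compact_unit_sphere n H.
have [||u /set_mem [uH u1] umax] := EVT_max_rV (f := fun x => dot (x *m S) x) _ cH.
- have x0 : vpick H != 0 by rewrite vpick0.
  exists ((Num.sqrt (dot (vpick H) (vpick H)))^-1 *: vpick H); split => /=.
    by rewrite memvZ ?memv_pick.
  exact: dot_normalize.
- apply: continuous_subspaceT; apply: dot_continuous => [|x]; last exact: cvg_id.
  exact: mulmx_continuous.
have qmax h : h \in H -> dot (h *m S) h <= dot (u *m S) u * dot h h.
  move=> hH; have [->|h0] := eqVneq h 0; first by rewrite mul0mx !dot0l mulr0.
  pose c := (Num.sqrt (dot h h))^-1.
  have := umax (c *: h); rewrite inE /=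
    => /(_ (conj (memvZ _ hH) (dot_normalize h0))).
  have := dot_normalize h0; rewrite -/c -scalemxAl !dotE => c1 cq.
  have -> : dot (h *m S) h = c * (c * dot (h *m S) h) * dot h h.
    by rewrite -[LHS]mulr1 -c1; ring.
  by rewrite ler_wpM2r// dot_ge0.
(* This is [qmax] at [u + t *: w]: a term linear in [t] is bounded by a quadratic one for every [t],
   so its coefficient must vanish. *)
have var w t : w \in H -> dot u w = 0 -> 2 * t * dot (u *m S) w <=
    t ^+ 2 * (dot (u *m S) u * dot w w - dot (w *m S) w).
  move=> wH uw; have := qmax _ (memvD uH (memvZ t wH)).
  rewrite mulmxDl -scalemxAl !dotE (dotC w u) uw u1 (SC w u); lra.
exists u; split=> // h hH.
have wH : h - dot u h *: u \in H by rewrite memvB// memvZ.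
suff : dot (u *m S) (h - dot u h *: u) = 0 by rewrite !dotE; lra.
have uw : dot u (h - dot u h *: u) = 0 by rewrite !dotE u1; lra.
move: (h - _) uw wH => w uw wH.
have {}var t := var w t wH uw.
move: var; set b := dot _ w; set c := _ - _ => var.
apply/eqP; rewrite -sqrf_eq0 -[_ == 0]negbK; apply/negP => b0.
have {}b0 : 0 < b ^+ 2 by rewrite lt_neqAle eq_sym b0 sqr_ge0.
have c0 := normr_ge0 c.
(* With this [t], clearing denominators gives [2 b^2 (1 + |c|) <= b^2 c], impossible for [b != 0];
   the summand 1 keeps the denominator positive. *)
have := var (b / (1 + `|c|)).
have k0 : 0 < 1 + `|c| by lra.
rewrite -(ler_pM2r (exprn_gt0 2 k0)).
have -> : 2 * (b / (1 + `|c|)) * b * (1 + `|c|) ^+ 2 = 2 * b ^+ 2 * (1 + `|c|).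
  by field; rewrite gt_eqF.
have -> : (b / (1 + `|c|)) ^+ 2 * c * (1 + `|c|) ^+ 2 = b ^+ 2 * c.
  by field; rewrite gt_eqF.
have := ler_norm c; nra.
Qed.

(** Induction on the dimension: split off an eigenvector [u] and pass to its orthogonal complement
    in [H]. Since [S] need not map [H] to itself, the eigenvector equation is tested only against
    vectors of [H]; it concerns the compression of [S] to [H]. *)
Lemma orthonormal_eigenseq n (S : 'M[R]_n) (H : {vspace 'rV[R]_n}) :
  S^T = S ->
  exists s : seq 'rV[R]_n, [/\ size s = \dim H, {subset s <= H},
    forall i j, (i < size s)%N -> (j < size s)%N -> dot s`_i s`_j = (i == j)%:R &
    forall x h, x \in s -> h \in H -> dot (x *m S) h = dot (x *m S) x * dot x h].
Proof.
move=> ST; move dE : (\dim H) => d; elim: d H dE => [|d IH] H dE.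
  by exists [::].
have H0 : H != 0%VS by rewrite -dimv_eq0 dE.
have [u [uH u1 uS]] := unit_eigenvector ST H0.
(* The functional [dot _ u], whose kernel cuts out the complement of [u]; it has rank 1 on [H]
   because [f u] is nonzero. *)
pose f : 'Hom('rV[R]_n, 'rV[R]_1) := linfun (mulmxr u^T).
have fE h : f h = (dot h u)%:M.
  rewrite lfunE/=; apply/matrixP => i j; rewrite !mxE !ord1 eqxx mulr1n.
  by apply: eq_bigr => k _; rewrite !mxE.
pose H' := (H :&: lker f)%VS.
have memH' h : (h \in H') = (h \in H) && (dot u h == 0).
  rewrite memv_cap memv_ker fE dotC; congr (_ && _).
  by apply/eqP/eqP => [/matrixP/(_ 0 0)|->]; rewrite ?mxE ?eqxx ?mulr1n ?raddf0.
have dH' : \dim H' = d.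
  have := limg_ker_dim f H; rewrite dE -/H' => dimE.
  suff f1 : \dim (f @: H) = 1%N by move: dimE; rewrite f1 addn1 => -[].
  apply/eqP; rewrite eqn_leq (leq_trans (dimvS (subvf _))) ?dimvf ?dim_matrix//=.
  rewrite lt0n dimv_eq0; apply/eqP => fH0.
  have := memv_img f uH; rewrite fH0 memv0 fE u1 => /eqP/matrixP/(_ 0 0)/eqP.
  by rewrite !mxE eqxx oner_eq0.
have [s [sd sH sorth sS]] := IH _ dH'.
exists (u :: s); split.
- by rewrite /= sd.
- move=> x; rewrite inE => /predU1P[->//|/sH]; by rewrite memH' => /andP[].
- have us i : (i < size s)%N -> dot u s`_i = 0.
    by move=> /(mem_nth 0)/sH; rewrite memH' => /andP[_ /eqP].
  case=> [|i] [|j]//= il jl; rewrite ?us//.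
    by rewrite dotC us.
  by rewrite sorth.
move=> x h; rewrite inE => /predU1P[->|xs] hH; first exact: uS.
have := sH _ xs; rewrite memH' => /andP[xH /eqP ux].
have wH : h - dot u h *: u \in H'.
  by rewrite memH' memvB ?memvZ//= !dotE u1 mulr1 subrr.
have := sS _ _ xs wH.
(* By symmetry of [S], the component of [h] along [u] contributes nothing, so the equation on [H']
   extends to [H]. *)
have : dot (x *m S) u = 0 by rewrite dot_mulmxl ST dotC uS// ux mulr0.
by rewrite !dotE (dotC x u) ux => ->; lra.
Qed.

Lemma orthonormal_eigenbasis n (S : 'M[R]_n) (H : {vspace 'rV[R]_n}) :
  S^T = S ->
  exists e : (\dim H).-tuple 'rV[R]_n, orthonormal_basis e /\
    forall i h, h \in H ->
      dot (tnth e i *m S) h = dot (tnth e i *m S) (tnth e i) * dot (tnth e i) h.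
Proof.
move=> ST; have [s [/eqP sd sH sorth sS]] := orthonormal_eigenseq H ST.
exists (Tuple sd).
have orth (i j : 'I_(\dim H)) :
    dot (tnth (Tuple sd) i) (tnth (Tuple sd) j) = (i == j)%:R.
  by rewrite !(tnth_nth 0)/= sorth// (eqP sd).
have nthE (j : 'I_(\dim H)) : (Tuple sd)`_j = tnth (Tuple sd) j.
  by rewrite (tnth_nth 0).
split; last by move=> i h; apply: sS; rewrite mem_tnth.
split=> //; rewrite basisEfree size_tuple leqnn andbT; apply/andP; split.
  apply/freeP => k k0 i; have := congr1 (dot (tnth (Tuple sd) i)) k0.
  rewrite [RHS]dotC dot0l dot_sumr (bigD1 i)//= nthE dotZr orth eqxx mulr1.
  rewrite big1 ?addr0// => j ji; rewrite nthE dotZr orth eq_sym (negbTE ji).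
  by rewrite mulr0.
by apply/span_subvP.
Qed.

End Spectral.

(** * Reflections, convexity, ellipsoids and rotations *)

Section Bodies.
Context {R : realType}.

Lemma reflectionK n (e x : 'rV[R]_n) : dot e e = 1 ->
  reflection e (reflection e x) = x.
Proof.
move=> e1; rewrite /reflection !dotE e1 mulr1 -addrA -opprD -scalerDl.
by rewrite [X in X *: _](_ : _ = 0) ?scale0r ?subr0//; ring.
Qed.

Lemma dot_reflectionC n (e x y : 'rV[R]_n) :
  dot (reflection e x) y = dot x (reflection e y).
Proof. by rewrite /reflection !dotE (dotC y e); ring. Qed.

Lemma dot_reflection n (e x y : 'rV[R]_n) : dot e e = 1 ->
  dot (reflection e x) (reflection e y) = dot x y.
Proof. by move=> e1; rewrite dot_reflectionC reflectionK. Qed.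

Lemma memv_reflection n (H : {vspace 'rV[R]_n}) e x :
  e \in H -> x \in H -> reflection e x \in H.
Proof. by move=> eH xH; rewrite memvB// memvZ. Qed.

(** Reflections are involutions, so mapping [A] into itself already means mapping it onto itself. *)
Lemma unconditional_stable n (H : {vspace 'rV[R]_n}) (A : set 'rV[R]_n)
    (e : (\dim H).-tuple 'rV[R]_n) :
  A `<=` [set` H] -> orthonormal_basis e ->
  (forall i x, A x -> A (reflection (tnth e i) x)) -> unconditional H A.
Proof.
move=> AH ob Ae; split=> //; exists e; split=> // i; apply/seteqP; split=> x /=.
  by move=> [y Ay <-]; exact: Ae.
move=> Ax; exists (reflection (tnth e i) x); first exact: Ae.
by rewrite reflectionK//; case: ob => _ ->; rewrite eqxx.
Qed.

Lemma convex_setP n (A : set 'rV[R]_n) :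
  (forall x y t, 0 <= t <= 1 -> A x -> A y -> A (t *: x + (1 - t) *: y)) ->
  convex_set A.
Proof.
move=> cA x y l; rewrite !inE => Ax Ay; apply: cA => //.
by rewrite ge0 le1.
Qed.

Lemma dot_conv_le1 n (x y : 'rV[R]_n) t : 0 <= t <= 1 ->
  dot x x <= 1 -> dot y y <= 1 ->
  dot (t *: x + (1 - t) *: y) (t *: x + (1 - t) *: y) <= 1.
Proof.
move=> /andP[t0 t1] xx yy.
have -> : dot (t *: x + (1 - t) *: y) (t *: x + (1 - t) *: y) =
    t * dot x x + (1 - t) * dot y y - t * (1 - t) * dot (x - y) (x - y).
  by rewrite !dotE (dotC y x); ring.
have t2 : 0 <= 1 - t by rewrite subr_ge0.
have := ler_wpM2l t0 xx; have := ler_wpM2l t2 yy.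
have := mulr_ge0 (mulr_ge0 t0 t2) (dot_ge0 (x - y)); lra.
Qed.

Lemma interior_unit_ball n (K : set 'rV[R]_n) (M : 'M[R]_n) :
  [set x | dot x x < 1] `&` [set x | dot (x *m M) (x *m M) < 1] `<=` K ->
  K° !=set0.
Proof.
move=> UK; exists 0; rewrite /interior.
apply: filterS UK _.
apply: open_nbhs_nbhs; split; last by rewrite /= mul0mx dot0l.
apply: openI.
  apply: (@open_comp _ _ (fun x : 'rV[R]_n => dot x x) [set r | r < 1]);
    last exact: open_lt.
  by move=> x _; exact: sqr_dot_continuous.
apply: (@open_comp _ _ (fun x : 'rV[R]_n => dot (x *m M) (x *m M)) [set r | r < 1]);
    last exact: open_lt.
by move=> x _; exact: sqr_dot_mulmx_continuous.
Qed.

Lemma compact_unit_ball n : compact [set x : 'rV[R]_n | dot x x <= 1].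
Proof.
apply: bounded_closed_compact; first exact: (@bounded_dot _ _ _ 1).
apply: (@closed_comp _ _ (fun x : 'rV[R]_n => dot x x) [set r | r <= 1]);
    last exact: closed_le.
by move=> x _; exact: sqr_dot_continuous.
Qed.

(** Strict convexity: the midpoint of two distinct points is interior, so it can be pushed slightly
    away from the origin. This will exclude bodies with a segment in their boundary. *)
Lemma ellipsoid_midpoint n (K : set 'rV[R]_n) p q :
  ellipsoid K -> K p -> K q -> p != q ->
  exists2 t, 0 < t & K ((1 + t) *: (2^-1 *: (p + q))).
Proof.
move=> [c [A [Au ->]]] [x /= x1 <-] [y /= y1 <-] pq.
have xy : x - y != 0.
  by apply: contraNneq pq => /eqP; rewrite subr_eq0 => /eqP ->.
pose m := 2^-1 *: (c + x *m A + (c + y *m A)).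
pose w := m *m invmx A.
pose z := 2^-1 *: (x + y).
have zz : dot z z < 1.
  have := dot_gt0 xy; rewrite /z !dotE (dotC y x); lra.
(* The summand [1 - dot z z] makes [b] positive and [t <= 1]; then [t^2 <= t] gives
   [|z + t w|^2 <= |z|^2 + t b = 1]. *)
pose b := 1 - dot z z + 2 * `|dot z w| + dot w w.
have [az ww] := (normr_ge0 (dot z w), dot_ge0 w).
have b0 : 0 < b by rewrite /b; lra.
pose t := (1 - dot z z) / b.
have t0 : 0 < t by rewrite divr_gt0//; lra.
have tb : t * b = 1 - dot z z by rewrite /t divfK// gt_eqF.
have t1 : t <= 1 by rewrite /t ler_pdivrMr// /b; lra.
have wA : w *m A = m by rewrite mulmxKV.
have zA : c + z *m A = m.
  rewrite /m /z -scalemxAl mulmxDl addrACA [RHS]scalerDr; congr (_ + _).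
  by rewrite -mulr2n -(scaler_nat 2 c) scalerA mulVf ?scale1r// pnatr_eq0.
exists t => //; rewrite -/m; clearbody w z m t.
exists (z + t *: w) => /=; last first.
  by rewrite mulmxDl -scalemxAl wA addrA zA scalerDl scale1r.
rewrite !dotE (dotC w z); have := ler_norm (dot z w).
rewrite /b in tb; nra.
Qed.

Lemma rotation_tr n (Q : 'M[R]_n) : rotation Q -> rotation Q^T.
Proof. by move=> [QQ dQ]; split; rewrite ?det_tr// trmxK; exact: mulmx1C. Qed.

Lemma dot_rotation n (Q : 'M[R]_n) x y : rotation Q ->
  dot (x *m Q) (y *m Q) = dot x y.
Proof. by move=> [QQ _]; rewrite dot_mulmxl -mulmxA QQ mulmx1. Qed.

Lemma orthogonal_dot n (G : 'M[R]_n) :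
  (forall x y, dot (x *m G) (y *m G) = dot x y) -> G *m G^T = 1%:M.
Proof.
move=> Gd; apply/matrixP => i j.
have := Gd (delta_mx 0 i) (delta_mx 0 j); rewrite -coord_dot -!rowE.
rewrite [in RHS]mxE eqxx/= => Gij; rewrite [RHS]mxE eq_sym -Gij mxE.
by apply: eq_bigr => k _; rewrite !mxE.
Qed.

(* An affine axis p + R u of a bounded origin symmetric body may be moved to
   the origin: composing the rotation about it with the inverse of its
   conjugate by -1 is a translation by 2(p - p Q^T), which must vanish. *)
Lemma revolution_linear n (K : set 'rV[R]_n) :
  origin_symmetric K -> compact K -> K !=set0 ->
  body_of_revolution K ->
  exists2 u : 'rV[R]_n, u != 0 & forall Q : 'M[R]_n, rotation Q -> u *m Q = u ->
    forall x, K (x *m Q) <-> K x.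
Proof.
move=> Ks cK [x0 Kx0] [p [u [u0 Krot]]]; exists u => //.
have [C KC] : exists C, forall x, K x -> dot x x <= C.
  have [||z _ Kz] := EVT_max_rV (f := fun x => dot x x) _ cK.
  - by exists x0.
  - by apply: continuous_subspaceT; exact: sqr_dot_continuous.
  by exists (dot z z) => x Kx; apply: Kz; rewrite inE.
have KN x : K x -> K (- x) by move=> Kx; rewrite -Ks; exists x.
have T (Q : 'M[R]_n) x : rotation Q -> u *m Q = u -> K x -> K (p + (x - p) *m Q).
  by move=> rQ uQ Kx; rewrite -(Krot Q rQ uQ); exists x.
have uT (Q : 'M[R]_n) : rotation Q -> u *m Q = u -> u *m Q^T = u.
  by move=> [QQ _] uQ; rewrite -{1}uQ -mulmxA QQ mulmx1.
have pQ (Q : 'M[R]_n) : rotation Q -> u *m Q = u -> p *m Q = p.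
  move=> rQ uQ; pose v := 2%:R *: (p - p *m Q).
  have Kv x : K x -> K (x + v).
    move=> Kx; have := T _ _ (rotation_tr rQ) (uT _ rQ uQ) (KN _ Kx).
    move=> /KN/(T _ _ rQ uQ); congr K.
    rewrite /v scaler_nat mulr2n opprD mulmxBl mulmxDl !mulNmx -mulmxA.
    case: (rotation_tr rQ) => /= + _; rewrite trmxK => ->.
    rewrite mulmx1 !opprD !opprK.
    by apply/rowP => i; rewrite !mxE; ring.
  have Kvk k : K (x0 + k%:R *: v).
    elim: k => [|k IH]; first by rewrite scale0r addr0.
    by rewrite -natr1 scalerDl scale1r addrA; exact: Kv.
  suff : v == 0.
    by rewrite scaler_eq0 pnatr_eq0/= subr_eq0 => /eqP <-.
  apply: contraT => v0; clearbody v; have vv := dot_gt0 v0.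
  (* the parallelogram law bounds k v in terms of x0 and x0 + k v *)
  have bk k : k%:R ^+ 2 * dot v v <= 4 * C.
    have := dot_ge0 (x0 + x0 + k%:R *: v); have := KC _ (Kvk k); have := KC _ Kx0.
    rewrite !dotE (dotC v x0); lra.
  have C0 : 0 <= 4 * C / dot v v.
    rewrite divr_ge0 ?dot_ge0// mulr_ge0//.
    exact: le_trans (dot_ge0 x0) (KC _ Kx0).
  (* For [k] above [4 C / |v|^2] the bound [bk] yields [k^2 < k], which no natural number
     satisfies. *)
  have := archi_boundP C0; move: (Num.bound _) => k.
  rewrite ltr_pdivrMr// => kC; have := le_lt_trans (bk k) kC.
  rewrite ltr_pM2r// -natrX ltr_nat; case: k {kC} => [|k]//.
  by rewrite ltnNge leq_pmull.
have Kdir (Q : 'M[R]_n) x : rotation Q -> u *m Q = u -> K x -> K (x *m Q).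
  move=> rQ uQ /(T _ _ rQ uQ); rewrite mulmxBl (pQ _ rQ uQ).
  by rewrite addrC subrK.
move=> Q rQ uQ x; split; last exact: Kdir.
move=> /(Kdir _ _ (rotation_tr rQ) (uT _ rQ uQ)).
by case: rQ => QQ _; rewrite -mulmxA QQ mulmx1.
Qed.

Lemma quarter_turn n (x y : 'rV[R]_n) :
  dot x x = 1 -> dot y y = 1 -> dot x y = 0 ->
  exists2 Q : 'M[R]_n, rotation Q & [/\ x *m Q = y, y *m Q = - x &
    forall z, dot z x = 0 -> dot z y = 0 -> z *m Q = z].
Proof.
move=> x1 y1 xy; have yx : dot y x = 0 by rewrite dotC.
(* Both the cosine and the sine of pi/4. *)
pose c : R := Num.sqrt 2^-1.
have cc : c ^+ 2 = 2^-1 by rewrite sqr_sqrtr// invr_ge0.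
(* the square of the rotation by pi/4: hence its determinant is 1 *)
pose G : 'M[R]_n := 1%:M + (c - 1) *: (x^T *m x + y^T *m y) +
  c *: (x^T *m y - y^T *m x).
have outer (z v w : 'rV[R]_n) : z *m (v^T *m w) = dot z v *: w.
  rewrite mulmxA; apply/rowP => i; rewrite !mxE big_ord1; congr (_ * _).
  by rewrite mxE; apply: eq_bigr => j _; rewrite mxE.
have GE z : z *m G = z + (c - 1) *: (dot z x *: x + dot z y *: y) +
    c *: (dot z x *: y - dot z y *: x).
  by rewrite /G !mulmxDr mulmx1 -!scalemxAr !mulmxDr mulmxN !outer.
clearbody G.
have GG : G *m G^T = 1%:M.
  apply: orthogonal_dot => z w; rewrite !GE !dotE x1 y1 xy yx.
  rewrite (dotC x w) (dotC y w); apply/eqP; rewrite -subr_eq0.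
  apply/eqP; transitivity ((2 * c ^+ 2 - 1) * (dot z x * dot w x + dot z y * dot w y)).
    by ring.
  by rewrite cc divff ?subrr ?mul0r// pnatr_eq0.
have xG : x *m G = c *: (x + y).
  by rewrite GE x1 xy; apply/rowP => i; rewrite !mxE; ring.
have yG : y *m G = c *: (y - x).
  by rewrite GE y1 yx; apply/rowP => i; rewrite !mxE; ring.
exists (G *m G).
  split; first by rewrite trmx_mul mulmxA -(mulmxA G G) GG mulmx1.
  by rewrite det_mulmx -{2}(det_tr G) -det_mulmx GG det1.
have c2 : c * c * 2 = 1 by rewrite -expr2 cc mulVf// pnatr_eq0.
split=> [||z zx zy]; rewrite ?mulmxA.
- rewrite xG -scalemxAl mulmxDl xG yG; apply/rowP => i; rewrite !mxE.
  by rewrite -[RHS]mul1r -c2; ring.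
- rewrite yG -scalemxAl mulmxBl xG yG; apply/rowP => i; rewrite !mxE.
  by rewrite -[RHS]mul1r -c2; ring.
have zG : z *m G = z by rewrite GE zx zy !scale0r addr0 subr0 !scaler0 !addr0.
by rewrite !zG.
Qed.

(** Two linear equations in at least three unknowns have a nonzero solution. *)
Lemma exists_orthogonal2 n (u v : 'rV[R]_n) : (3 <= n)%N ->
  exists b : 'rV[R]_n, [/\ dot b b = 1, dot b u = 0 & dot b v = 0].
Proof.
move=> n3; pose A := col_mx u v.
have : kermx A^T != 0.
  rewrite -mxrank_eq0 mxrank_ker -lt0n subn_gt0.
  by rewrite (leq_ltn_trans (rank_leq_col _)).
move=> /rowV0Pn[b /sub_kermxP bA b0].
have /eq_row_mx[bu bv] : row_mx (b *m u^T) (b *m v^T) = row_mx 0 0.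
  by rewrite -mul_mx_row -tr_col_mx bA row_mx0.
have dE w : b *m w^T = 0 -> dot b w = 0.
  move=> /matrixP/(_ 0 0); rewrite !mxE => bw; rewrite -[RHS]bw.
  by apply: eq_bigr => i _; rewrite mxE.
exists ((Num.sqrt (dot b b))^-1 *: b); split; first exact: dot_normalize.
  by rewrite dotZl (dE _ bu) mulr0.
by rewrite dotZl (dE _ bv) mulr0.
Qed.

End Bodies.

(** * The two constructions, their symmetries, and a criterion against revolution *)

Section Examples.
Context {R : realType}.

Definition ball_cap n (M : 'M[R]_n) : set 'rV[R]_n :=
  [set x | dot x x <= 1] `&` [set x | dot (x *m M) (x *m M) <= 1].

Definition ball_sum n (M : 'M[R]_n) : set 'rV[R]_n :=
  [set v.1 + v.2 *m M | v in
    [set x | dot x x <= 1] `*` [set x | dot x x <= 1]].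

Lemma ball_cap_convex_body n (M : 'M[R]_n) : convex_body (ball_cap M).
Proof.
split.
- apply: bounded_closed_compact.
    by apply: (@bounded_dot _ _ _ 1) => x [].
  apply: closedI.
    apply: (@closed_comp _ _ (fun x : 'rV[R]_n => dot x x) [set r | r <= 1]);
      last exact: closed_le.
    by move=> x _; exact: sqr_dot_continuous.
  apply: (@closed_comp _ _ (fun x : 'rV[R]_n => dot (x *m M) (x *m M))
    [set r | r <= 1]);
    last exact: closed_le.
  by move=> x _; exact: sqr_dot_mulmx_continuous.
- apply: convex_setP => x y t t01 [/= x1 xM] [/= y1 yM]; split => /=.
    exact: dot_conv_le1.
  by rewrite mulmxDl -!scalemxAl; exact: dot_conv_le1.
- by apply: (@interior_unit_ball _ _ _ M) => x [/= x1 xM]; split; exact: ltW.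
Qed.

Lemma ball_sum_convex_body n (M : 'M[R]_n) : convex_body (ball_sum M).
Proof.
split.
- apply: continuous_compact; last by apply: compact_setX; exact: compact_unit_ball.
  apply: continuous_subspaceT => v; apply: cvgD; first exact: cvg_fst.
  apply: (@continuous_comp _ _ _ snd (fun x : 'rV[R]_n => x *m M)).
    exact: cvg_snd.
  exact: mulmx_continuous.
- apply: convex_setP => _ _ t t01 [[x y]/= [x1 y1] <-] [[x' y']/= [x1' y1'] <-].
  exists (t *: x + (1 - t) *: x', t *: y + (1 - t) *: y') => /=.
    by split; exact: dot_conv_le1.
  by rewrite mulmxDl -!scalemxAl !scalerDr addrACA.
(* The sum contains the unit ball; with the identity matrix the second condition merely repeats the
   first. *)
- apply: (@interior_unit_ball _ _ _ 1%:M) => x [/= x1 _].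
  exists (x, 0); rewrite /= ?mul0mx ?addr0//.
  by split; rewrite /= ?dot0l ?ler01// ltW.
Qed.

Lemma ball_cap_symmetric n (M : 'M[R]_n) : origin_symmetric (ball_cap M).
Proof.
have N x : ball_cap M x -> ball_cap M (- x).
  by move=> [/= x1 xM]; split; rewrite /= ?mulNmx !dotE opprK.
apply/seteqP; split=> [_ [x Kx <-]|x Kx]; first exact: N.
by exists (- x); [exact: N|rewrite opprK].
Qed.

Lemma ball_sum_symmetric n (M : 'M[R]_n) : origin_symmetric (ball_sum M).
Proof.
have N x : ball_sum M x -> ball_sum M (- x).
  move=> [[v w] [/= v1 w1] <-]; exists (- v, - w); last by rewrite /= mulNmx opprD.
  by split; rewrite /= !dotE opprK.
apply/seteqP; split=> [_ [x Kx <-]|x Kx]; first exact: N.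
by exists (- x); [exact: N|rewrite opprK].
Qed.

(** The form [|x M|^2] has matrix [M *m M^T]. In an orthonormal eigenbasis of its restriction to
    [H], both forms are diagonal, so changing the sign of one coordinate preserves both
    inequalities. *)
Lemma ball_cap_section n (M : 'M[R]_n) (H : {vspace 'rV[R]_n}) :
  unconditional H (section (ball_cap M) H).
Proof.
have ST : (M *m M^T)^T = M *m M^T by rewrite trmx_mul trmxK.
have [e [ob eS]] := orthonormal_eigenbasis H ST.
apply: (unconditional_stable _ ob) => [x []//|i x [[/= x1 xM] xH]].
case: ob => [be oe].
have ei1 : dot (tnth e i) (tnth e i) = 1 by rewrite oe eqxx.
have eiH : tnth e i \in H by rewrite (basis_mem be)// mem_tnth.
split; last exact: memv_reflection.
split; first by rewrite /= dot_reflection.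
move: xM (eS i x xH); move: (tnth e i) ei1 eiH {eS oe} => u u1 uH.
rewrite /= /reflection mulmxBl -scalemxAl mulmxA => xM.
rewrite 2!(dot_mulmxl (u *m M)) trmxK => uM.
by rewrite !dotE (dotC (x *m M) (u *m M)) uM (dotC x u); lra.
Qed.

(** Dually, the support function of the sum is [|h| + |h M^T|], which suggests diagonalizing
    [M^T *m M] on [H]. The argument works with points: if [y] is the projection of [v + w M], its
    reflection is the projection of a sum of two reflected vectors. *)
Lemma ball_sum_projection n (M : 'M[R]_n) (H : {vspace 'rV[R]_n}) :
  unconditional H (projection (ball_sum M) H).
Proof.
have ST : (M^T *m M)^T = M^T *m M by rewrite trmx_mul trmxK.
have [e [ob eS]] := orthonormal_eigenbasis H ST.
apply: (unconditional_stable _ ob) => [x []//|i y [yH [_ [[v w] [/= v1 w1] <-] yp]]].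
case: ob => [be oe].
have ei1 : dot (tnth e i) (tnth e i) = 1 by rewrite oe eqxx.
have eiH : tnth e i \in H by rewrite (basis_mem be)// mem_tnth.
move: (eS i); move: (tnth e i) ei1 eiH {eS oe} => u u1 uH uS.
pose f := u *m M^T.
have fE x : dot (x *m M) u = dot x f by rewrite dot_mulmxl.
have fM h : h \in H -> dot (f *m M) h = dot f f * dot u h.
  by move=> hH; rewrite -mulmxA uS// mulmxA fE.
clearbody f.
(* On H, the reflection in u of w M agrees with w' M, where w' is the
   reflection of w in f; if f = 0, both fix their argument (x / 0 = 0). *)
pose w' := w - (2 * dot w f / dot f f) *: f.
have ff : f = 0 \/ dot f f != 0.
  by have [->|f0] := eqVneq f 0; [left|right; rewrite dot_eq0].
have w'1 : dot w' w' = dot w w.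
  rewrite /w'; case: ff => [->|ff]; first by rewrite scaler0 subr0.
  by rewrite !dotE (dotC f w); field.
have w'M h : h \in H -> dot (w' *m M) h = dot (w *m M) h - 2 * dot w f * dot u h.
  move=> hH; rewrite /w' mulmxBl -scalemxAl !dotE fM//.
  case: ff => [->|ff]; first by rewrite (dotC w) !dot0l; ring.
  by field.
split; first exact: memv_reflection.
exists (reflection u v + w' *m M).
  exists (reflection u v, w') => //; split; first by rewrite /= dot_reflection.
  by rewrite /= w'1.
(* Reflections are self-adjoint and preserve [H], so the orthogonality of the old residual is tested
   against the reflected [h]. *)
move=> h hH; have := yp _ (memv_reflection uH hH).
have dE a b c (z : 'rV[R]_n) : dot (a + b - c) z = dot a z + dot b z - dot c z.
  by rewrite !dotE.
have wr : dot (w *m M) (reflection u h) = dot (w *m M) h - 2 * dot w f * dot u h.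
  by rewrite /reflection dotDr dotNr dotZr fE (dotC h u); ring.
by rewrite !dE w'M// !dot_reflectionC wr; lra.
Qed.

(** As [d 0 j] strictly dominates, the first condition on symmetries makes each of them preserve the
    line of ['e_j]. An axis off this line admits a quarter turn moving the line; an axis along it
    admits the turn excluded by the last condition. *)
Lemma not_revolution n (K : set 'rV[R]_n) (d : 'rV[R]_n) (i j k : 'I_n) :
  (3 <= n)%N -> j != i -> j != k -> i != k ->
  (forall l, l != j -> `|d 0 l| < d 0 j) ->
  origin_symmetric K -> compact K -> K !=set0 ->
  (forall Q : 'M[R]_n, rotation Q -> (forall x, K (x *m Q) <-> K x) ->
    let y : 'rV[R]_n := 'e_j *m Q in
    d 0 j ^+ 2 <= dot (y *m diag_mx d) (y *m diag_mx d)) ->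
  (forall Q : 'M[R]_n, rotation Q -> (forall x, K (x *m Q) <-> K x) ->
     'e_k *m Q = 'e_i :> 'rV[R]_n ->
     'e_i *m Q = - 'e_k :> 'rV[R]_n -> False) ->
  ~ body_of_revolution K.
Proof.
move=> n3 ji jk ik dj Ks cK K0 Kj Kik /(revolution_linear Ks cK K0)[u u0 uK].
have dd (l m : 'I_n) : dot ('e_l : 'rV[R]_n) 'e_m = (m == l)%:R.
  by rewrite -coord_dot mxE eqxx.
have dj0 : 0 < d 0 j by rewrite (le_lt_trans _ (dj i _))// eq_sym.
have Qj (Q : 'M[R]_n) : rotation Q -> u *m Q = u ->
    forall l, l != j -> ('e_j *m Q : 'rV[R]_n) 0 l = 0.
  move=> rQ uQ; have := Kj _ rQ (uK _ rQ uQ).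
  have : dot ('e_j *m Q : 'rV[R]_n) ('e_j *m Q) = 1.
    by rewrite dot_rotation// dd eqxx.
  move: ('e_j *m Q : 'rV[R]_n) => /= y y1 yd l lj.
  have pos m : 0 <= (d 0 j ^+ 2 - d 0 m ^+ 2) * y 0 m ^+ 2.
    rewrite mulr_ge0 ?sqr_ge0// subr_ge0 -[X in X <= _]real_normK ?num_real//.
    have [->|mj] := eqVneq m j; first by rewrite ger0_norm// ltW.
    by rewrite ler_pXn2r// ?nnegrE ?normr_ge0// ltW// dj.
  (* Since [|y| = 1], the sum equals [d_j^2 - |y diag(d)|^2 <= 0], while its terms are nonnegative;
     hence each term vanishes. *)
  have : \sum_m (d 0 j ^+ 2 - d 0 m ^+ 2) * y 0 m ^+ 2 = 0.
    apply/eqP; rewrite eq_le sumr_ge0 ?andbT//.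
    move: yd; rewrite -subr_le0; apply: le_trans; rewrite le_eqVlt.
    apply/orP; left; apply/eqP; rewrite -[X in X - _]mulr1 -[X in _ * X - _]y1.
    rewrite [in RHS]/dot mulr_sumr -sumrB; apply: eq_bigr => m _.
    by rewrite mul_mx_diag mxE; ring.
  move=> /psumr_eq0P-/(_ (fun m _ => pos m) l isT)/eqP.
  rewrite mulf_eq0 sqrf_eq0 subr_eq0 => /orP[|/eqP//].
  rewrite -[X in _ == X]real_normK ?num_real// eqrXn2 ?normr_ge0 ?ltW// => /eqP djl.
  by have := dj _ lj; rewrite -djl ltxx.
have uu := dot_gt0 u0.
pose c := dot 'e_j u / dot u u.
pose w := 'e_j - c *: u.
have jE : 'e_j = c *: u + w by rewrite addrC subrK.
have wu : dot w u = 0 by rewrite /w !dotE /c divfK ?subrr// gt_eqF.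
clearbody w c.
have [w0|w0] := eqVneq w 0.
  have cu : 'e_j = c *: u by rewrite jE w0 addr0.
  have c0 : c != 0.
    apply/eqP => c0; have := dd j j; rewrite {1}cu c0 scale0r dot0l eqxx => /eqP.
    by rewrite eq_sym oner_eq0.
  have uE : u = c^-1 *: 'e_j by rewrite cu scalerA mulVf// scale1r.
  have [|||Q rQ [kQ iQ uQ]] := @quarter_turn R n 'e_k 'e_i.
  - by rewrite dd eqxx.
  - by rewrite dd eqxx.
  - by rewrite dd (negbTE ik).
  apply: (Kik Q rQ _ kQ iQ); apply: uK => //; apply: uQ.
    by rewrite uE dotZl dd eq_sym (negbTE jk) mulr0.
  by rewrite uE dotZl dd eq_sym (negbTE ji) mulr0.
(* Turning the direction of [w] to [b] fixes [u] and sends ['e_j] to [c u + r b]. Its product with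
   [b] is [r != 0], although it should be a multiple of ['e_j], which is orthogonal to [b]. *)
have [b [b1 bu bj]] := exists_orthogonal2 u 'e_j n3.
pose r := Num.sqrt (dot w w).
have r0 : r != 0 by rewrite sqrtr_eq0 -ltNge dot_gt0.
have bw : dot b w = 0.
  by move: bj; rewrite jE dotDr dotZr bu mulr0 add0r.
have [|||Q rQ [wQ _ uQ]] := @quarter_turn R n (r^-1 *: w) b => //.
- exact: dot_normalize.
- by rewrite dotZl dotC bw mulr0.
have {}uQ : u *m Q = u.
  by apply: uQ; rewrite ?dotZr dotC ?wu ?mulr0.
have := Qj Q rQ uQ.
have wE : w *m Q = r *: b by rewrite -wQ -scalemxAl scalerA divff// scale1r.
have : dot ('e_j *m Q : 'rV[R]_n) b = r.
  by rewrite jE mulmxDl -scalemxAl uQ wE !dotE (dotC u) bu b1 mulr0 add0r mulr1.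
move: ('e_j *m Q : 'rV[R]_n) => y yb yl; move/eqP: r0; apply.
rewrite -yb /dot big1// => l _; have [->|lj] := eqVneq l j.
  by rewrite (coord_dot b) bj mulr0.
by rewrite yl// mul0r.
Qed.

End Examples.

(** The nonzero entries are the semiaxes of the flat ellipse in the sum, but the reciprocals of
    those of the cylinder in the intersection. *)
Definition semiaxes {R : realType} n (i j : 'I_n) : 'rV[R]_n :=
  \row_l (if l == i then 2 else if l == j then 3 else 0).

(** * Neither concrete body is an ellipsoid or a body of revolution *)

Section SemiaxesExamples.
Context {R : realType} {n : nat} {i j k : 'I_n}.
Context (ji : j != i) (jk : j != k) (ik : i != k).

Let M : 'M[R]_n := diag_mx (semiaxes i j).

Let dot_basis (l m : 'I_n) : dot ('e_l : 'rV[R]_n) 'e_m = (l == m)%:R.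
Proof. by rewrite -coord_dot mxE eqxx eq_sym. Qed.

Let basisM (l : 'I_n) : 'e_l *m M = semiaxes i j 0 l *: ('e_l : 'rV[R]_n).
Proof.
apply/rowP => m; rewrite mul_mx_diag !mxE eqxx/=; have [->|_] := eqVneq m l.
  by rewrite mulrC.
by rewrite mul0r mulr0.
Qed.

Let basisM_i : 'e_i *m M = 2 *: ('e_i : 'rV[R]_n).
Proof. by rewrite basisM mxE eqxx. Qed.

Let basisM_j : 'e_j *m M = 3 *: ('e_j : 'rV[R]_n).
Proof. by rewrite basisM mxE (negbTE ji) eqxx. Qed.

Let basisM_k : 'e_k *m M = 0 :> 'rV[R]_n.
Proof. by rewrite basisM mxE eq_sym (negbTE ik) eq_sym (negbTE jk) scale0r. Qed.

Let semiaxes_lt (l : 'I_n) : l != j -> `|semiaxes i j 0 l : R| < semiaxes i j 0 j.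
Proof.
move=> lj; rewrite !mxE (negbTE ji) eqxx (negbTE lj).
by case: ifP => _; rewrite ?normr0 ?ltr0n// ger0_norm// ltr_nat.
Qed.

Let dot_ik : dot ('e_i : 'rV[R]_n) 'e_k = 0.
Proof. by rewrite dot_basis (negbTE ik). Qed.

Let dot_ki : dot ('e_k : 'rV[R]_n) 'e_i = 0.
Proof. by rewrite dotC dot_ik. Qed.

Let dot_ll (l : 'I_n) : dot ('e_l : 'rV[R]_n) 'e_l = 1.
Proof. by rewrite dot_basis eqxx. Qed.

(** The cylinder is unbounded along ['e_k], so its boundary contains a segment in this direction
    through ['e_i / 2], short enough here to stay in the ball. *)
Lemma ball_cap_not_ellipsoid : ~ ellipsoid (ball_cap M).
Proof.
move=> /(@ellipsoid_midpoint _ _ _ (2^-1 *: 'e_i + 2^-1 *: 'e_k)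
  (2^-1 *: 'e_i - 2^-1 *: 'e_k)) [].
- split; rewrite /= ?mulmxDl -?scalemxAl ?basisM_i ?basisM_k ?scaler0;
  rewrite ?addr0 !dotE ?dot_ik ?dot_ki ?dot_ll; lra.
- split; rewrite /= ?mulmxBl -?scalemxAl ?basisM_i ?basisM_k ?scaler0;
  rewrite ?subr0 !dotE ?dot_ik ?dot_ki ?dot_ll; lra.
- apply/eqP => /(congr1 (dot ('e_k))); rewrite !dotE dot_ki dot_ll; lra.
move=> t t0 [_ /=]; rewrite addrACA subrr addr0 -!scalemxAl mulmxDl -!scalemxAl.
rewrite basisM_i !dotE dot_ll; nra.
Qed.

(** The ellipse has no extent along ['e_k], so the hyperplane at height 1 in this direction supports
    the sum and contains a translate of the ellipse, with the two points used. *)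
Lemma ball_sum_not_ellipsoid : ~ ellipsoid (ball_sum M).
Proof.
move=> /(@ellipsoid_midpoint _ _ _ ('e_k + 2 *: 'e_i) ('e_k - 2 *: 'e_i)) [].
- exists ('e_k, 'e_i); last by rewrite /= basisM_i.
  by split; rewrite /= dot_ll.
- exists ('e_k, - 'e_i); last by rewrite /= mulNmx basisM_i.
  by split; rewrite /= ?dotNl ?dotNr ?opprK dot_ll.
- apply/eqP => /(congr1 (dot 'e_i)); rewrite !dotE dot_ik dot_ll; lra.
move=> t t0 [[v w] [/= v1 w1]] /(congr1 (dot 'e_k)).
rewrite addrACA subrr addr0 !dotE dot_ll (dotC _ (w *m M)) dot_mulmxl.
rewrite tr_diag_mx -/M basisM_k (dotC w) dot0l => vk.
have := dot_ge0 (v - 'e_k); rewrite !dotE dot_ll (dotC v); lra.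
Qed.

Lemma ball_cap_not_revolution : (3 <= n)%N -> ~ body_of_revolution (ball_cap M).
Proof.
move=> n3; apply: (not_revolution n3 ji jk ik semiaxes_lt).
- exact: ball_cap_symmetric.
- by case: (ball_cap_convex_body M).
- by exists 0; split; rewrite /= ?mul0mx dot0l.
- move=> Q rQ KQ /=; rewrite -/M mxE (negbTE ji) eqxx.
  have := dot_ll j; rewrite -(dot_rotation _ _ rQ).
  rewrite leNgt => y1; apply/negP; set q := dot _ _ => q9.
  have q0 : 0 <= q := dot_ge0 _.
  have s0 : 0 < 9 + q by lra.
  (* If [q < 9] then [1/3 < s < 1], and [s^2 q <= 1] because [36 q <= (9 + q)^2]. So [s *: 'e_j]
     leaves the cylinder while its image under [Q] lies in the body. *)
  pose s := 6 / (9 + q).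
  have sE : s * (9 + q) = 6 by rewrite divfK// gt_eqF.
  have s1 : 1 < 3 * s by rewrite mulrA ltr_pdivlMr//; lra.
  clearbody s.
  have [] : ball_cap M (s *: 'e_j); last first.
    by move=> _ /=; rewrite -scalemxAl basisM_j !dotE dot_ll; nra.
  apply/KQ; rewrite -scalemxAl; split; rewrite /= -?scalemxAl !dotE ?y1 -/q.
    nra.
  nra.
(* The body contains ['e_k], but not its image ['e_i]. *)
move=> Q rQ KQ kQ _.
have : ball_cap M ('e_k *m Q).
  by apply/KQ; split; rewrite /= ?basisM_k ?dot0l ?dot_ll.
by rewrite kQ => -[_ /=]; rewrite basisM_i !dotE dot_ll; lra.
Qed.

Lemma ball_sum_not_revolution : (3 <= n)%N -> ~ body_of_revolution (ball_sum M).
Proof.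
move=> n3; apply: (not_revolution n3 ji jk ik semiaxes_lt).
- exact: ball_sum_symmetric.
- by case: (ball_sum_convex_body M).
- by exists 0; exists (0, 0); rewrite /= ?mul0mx ?addr0//; split; rewrite /= dot0l.
- move=> Q rQ KQ /=; rewrite -/M mxE (negbTE ji) eqxx.
  have := dot_ll j; rewrite -(dot_rotation _ _ rQ).
  (* The furthest point is [4 = 1 + 3] times ['e_j]. Writing its image as [4 y = v + w M], the bound
     [y.v <= 1] leaves [w.(y M) >= 3], and [|3 w - y M|^2 >= 0] then gives [|y M|^2 >= 9]. *)
  have : ball_sum M (4 *: 'e_j *m Q).
    apply/KQ; exists ('e_j, 'e_j); first by split; rewrite /= dot_ll.
    by rewrite /= basisM_j -{1}[ 'e_j]scale1r -scalerDl; congr (_ *: _); ring.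
  rewrite -scalemxAl; move: ('e_j *m Q : 'rV[R]_n) => y [[v w] [/= v1 w1]].
  move=> /(congr1 (dot y)) + y1; rewrite !dotE y1 (dotC _ (w *m M)) dot_mulmxl.
  rewrite tr_diag_mx -/M.
  have := dot_ge0 (v - y); have := dot_ge0 (3 *: w - y *m M).
  rewrite !dotE y1 (dotC v) (dotC _ w); lra.
move=> Q rQ KQ _ iQ.
(* The point [3 = 1 + 2] times ['e_i] would go to [- 3 *: 'e_k], yet the body has half-width 1 along
   ['e_k]. *)
have : ball_sum M (3 *: 'e_i *m Q).
  apply/KQ; exists ('e_i, 'e_i); first by split; rewrite /= dot_ll.
  by rewrite /= basisM_i -{1}[ 'e_i]scale1r -scalerDl; congr (_ *: _); ring.
rewrite -scalemxAl iQ => -[[v w] [/= v1 w1]] /(congr1 (dot 'e_k)).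
rewrite !dotE dot_ll (dotC _ (w *m M)) dot_mulmxl.
rewrite tr_diag_mx -/M basisM_k (dotC w) dot0l => vk.
have := dot_ge0 (v + 'e_k); rewrite !dotE dot_ll (dotC v); lra.
Qed.

End SemiaxesExamples.

Theorem proposition4p5 (R : realType) (n : nat) (hn : (3 <= n)%N) :
  (exists K : set 'rV[R]_n,
     [/\ convex_body K, origin_symmetric K, ~ ellipsoid K,
         ~ body_of_revolution K &
         forall H : {vspace 'rV[R]_n}, (1 <= \dim H <= n - 1)%N ->
           unconditional H (section K H)]) /\
  (exists K : set 'rV[R]_n,
     [/\ convex_body K, origin_symmetric K, ~ ellipsoid K,
         ~ body_of_revolution K &
         forall H : {vspace 'rV[R]_n}, (1 <= \dim H <= n - 1)%N ->
           unconditional H (projection K H)]).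
Proof.
(* Coordinates 0, 1 and 2, carrying the diagonal entries 2, 3 and 0. *)
pose i := Ordinal (ltnW (ltnW hn)); pose j := Ordinal (ltnW hn); pose k := Ordinal hn.
have [ji jk ik] : [/\ j != i, j != k & i != k] by [].
split.
  exists (ball_cap (diag_mx (semiaxes i j))); split.
  - exact: ball_cap_convex_body.
  - exact: ball_cap_symmetric.
  - exact: (ball_cap_not_ellipsoid (k := k)).
  - exact: (ball_cap_not_revolution (k := k)).
  - by move=> H _; exact: ball_cap_section.
exists (ball_sum (diag_mx (semiaxes i j))); split.
- exact: ball_sum_convex_body.
- exact: ball_sum_symmetric.
- exact: (ball_sum_not_ellipsoid (k := k)).
- exact: (ball_sum_not_revolution (k := k)).
- by move=> H _; exact: ball_sum_projection.
Qed.
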